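(* Let $k\geq 2$ be an even integer and let $G$ be a connected graph of order $n\geq 3$. (i) If $\lambda_1(D(G))\le \lambda_1(D(K_1\vee(K_{n-2}\cup K_1)))$ and $G\not\cong K_1\vee(K_{n-2}\cup K_1)$, then $G$ is $\mathrm{GFC}_k$ when $n$ is odd, and $G$ is $\mathrm{GBC}_k$ when $n$ is even with $n\geq 10$. (ii) If $n$ is even with $4\le n\le 8$ and $\lambda_1(D(G))\le \lambda_1(D(S_{n,\frac{n}{2}}))$, then $G$ is $\mathrm{GBC}_k$ unless $G\cong S_{n,\frac{n}{2}}$.
   Context: All graphs are finite, simple, undirected. For a connected graph $G$, $D(G)$ is its distance matrix (entry $(i,j)$ is the distance between $v_i$ and $v_j$) and $\lambda_1(D(G))$ its largest eigenvalue. $G\cup H$ is disjoint union, $G\vee H$ the join, $tK_1$ the edgeless graph on $t$ vertices, $S_{n,k}=K_k\vee(n-k)K_1$. For a graph $H$, $i(H)$ is the number of isolated vertices of $H$ and $\mathrm{odd}(H)$ the number of components of $H$ with an odd number ($\ge 3$) of vertices. The $k$-Berge–Tutte formula is $\mathrm{def}_k(G)=\max_{S\subseteq V(G)} \big(k\, i(G-S)-k|S|\big)$ if $k$ is even, and $\max_{S\subseteq V(G)}\big(\mathrm{odd}(G-S)+k\, i(G-S)-k|S|\big)$ if $k$ is odd; a set $S$ attaining the maximum is a $k$-barrier. A connected graph of odd order is $\mathrm{GFC}_k$ if it has no non-empty $k$-barrier; a connected graph of even order is $\mathrm{GBC}_k$ if it has no non-empty $k$-barrier. *)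

(* Defs.v *)
From HB Require Import structures.
From mathcomp Require Import all_boot all_order all_algebra.
From mathcomp Require Import classical_sets reals.
Set Implicit Arguments. Unset Strict Implicit. Unset Printing Implicit Defensive.
Import Order.TTheory GRing.Theory Num.Theory.

Definition simple_graph (n : nat) (e : rel 'I_n) : Prop :=
  symmetric e /\ irreflexive e.

Definition connected_graph (n : nat) (e : rel 'I_n) : Prop :=
  forall u v : 'I_n, connect e u v.

Definition graph_iso (n : nat) (e1 e2 : rel 'I_n) : Prop :=
  exists f : 'I_n -> 'I_n, bijective f /\ forall x y, e2 (f x) (f y) = e1 x y.

Fixpoint reach (n : nat) (e : rel 'I_n) (d : nat) (u v : 'I_n) : bool :=
  match d with
  | 0 => u == v
  | d'.+1 => reach e d' u v || [exists w, reach e d' u w && e w v]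
  end.

(* Distance: the least d (< n) such that v is reachable from u within d
   steps (for connected graphs every distance is < n). *)
Definition dist (n : nat) (e : rel 'I_n) (u v : 'I_n) : nat :=
  find (fun d => reach e d u v) (iota 0 n).

Definition dist_matrix (R : realType) (n : nat) (e : rel 'I_n) : 'M[R]_n :=
  (\matrix_(i, j) (dist e i j)%:R)%R.

Definition lambda1 (R : realType) (n : nat) (A : 'M[R]_n) : R :=
  sup [set a : R | eigenvalue A a].

(* K_1 \/ (K_{n-2} u K_1): vertex 0 is the K_1 joined to everything,
   vertices 1..n-2 form K_{n-2}, vertex n-1 is the isolated K_1. *)
Definition join_K1_Kn2_K1 (n : nat) : rel 'I_n :=
  fun x y => (x != y) &&
    [|| (x : nat) == 0, (y : nat) == 0 | ((x : nat) != n.-1) && ((y : nat) != n.-1)].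

(* S_{n,k} = K_k \/ (n-k)K_1 : vertices < k form the clique K_k. *)
Definition S_nk (n k : nat) : rel 'I_n :=
  fun x y => (x != y) && (((x : nat) < k) || ((y : nat) < k)).

Definition del_rel (n : nat) (e : rel 'I_n) (S : {set 'I_n}) : rel 'I_n :=
  fun x y => [&& x \notin S, y \notin S & e x y].

Definition iso_count (n : nat) (e : rel 'I_n) (S : {set 'I_n}) : nat :=
  #|[set x | (x \notin S) && [forall y, ~~ del_rel e S x y]]|.

Definition components (n : nat) (e : rel 'I_n) (S : {set 'I_n}) : {set {set 'I_n}} :=
  [set [set y | connect (del_rel e S) x y] | x in ~: S].

Definition odd_count (n : nat) (e : rel 'I_n) (S : {set 'I_n}) : nat :=
  #|[set C in components e S | odd #|C| && (3 <= #|C|)]|.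

(* The quantity maximized in the k-Berge-Tutte formula. *)
Definition bt_value (k n : nat) (e : rel 'I_n) (S : {set 'I_n}) : int :=
  if odd k then
    ((odd_count e S)%:Z + (k * iso_count e S)%:Z - (k * #|S|)%:Z)%R
  else ((k * iso_count e S)%:Z - (k * #|S|)%:Z)%R.

Definition k_barrier (k n : nat) (e : rel 'I_n) (S : {set 'I_n}) : Prop :=
  forall S' : {set 'I_n}, (bt_value k e S' <= bt_value k e S)%R.

Definition no_nonempty_barrier (k n : nat) (e : rel 'I_n) : Prop :=
  forall S : {set 'I_n}, S != finset.set0 -> ~ k_barrier k e S.

Definition GFC (k n : nat) (e : rel 'I_n) : Prop :=
  connected_graph e /\ odd n /\ no_nonempty_barrier k e.

Definition GBC (k n : nat) (e : rel 'I_n) : Prop :=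
  connected_graph e /\ ~~ odd n /\ no_nonempty_barrier k e.

Arguments join_K1_Kn2_K1 n : clear implicits.
Arguments S_nk n k : clear implicits.

(* Main.v *)
Require Import Defs.
From HB Require Import structures.
From mathcomp Require Import all_boot all_order all_algebra.
From mathcomp Require Import classical_sets reals.
From mathcomp Require Import boolp topology normedtype derive.
From mathcomp Require Import ring lra zify.
Set Implicit Arguments. Unset Strict Implicit. Unset Printing Implicit Defensive.
Import Order.TTheory GRing.Theory Num.Theory.
Import numFieldNormedType.Exports.

(** As [k] is even, comparing a non-empty barrier [S] with the empty set shows that its
    removal isolates at least [s = #|S|] vertices, so [G] is a spanning subgraph of
    [H_s = K_s \/ (K_{n-2s} u s K_1)] and [D(G) >= D(H_s)] entrywise.  If [s]
    is the value belonging to the reference graph ([s = 1] or [s = n/2]), pairing [D(G)]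
    with the positive Perron vector of the reference graph forces [G] to be that graph.
    Otherwise an explicit test vector constant on the three classes of [H_s] (all ones,
    except for [(n, s) = (5, 2)] and [(8, 1)]) has Rayleigh quotient above a
    rational [c], while a positive vector [y] with [D y <= c y] bounds the spectral
    radius of the reference graph by [c]. *)

(** * Rayleigh quotients and Perron vectors of real symmetric matrices *)

Section Rayleigh.
Local Open Scope ring_scope.
Variables (R : realType) (n : nat).
Implicit Types (A D : 'M[R]_n) (x y : 'I_n -> R) (c : R).

Definition mulv A x (i : 'I_n) : R := \sum_j A i j * x j.
Definition qform A x : R := \sum_i x i * mulv A x i.
Definition sqnorm x : R := \sum_i x i ^+ 2.

Lemma sqnorm_ge0 x : 0 <= sqnorm x.
Proof. by apply: sumr_ge0 => i _; apply: sqr_ge0. Qed.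

Lemma sqnorm_gt0 x i : x i != 0 -> 0 < sqnorm x.
Proof.
move=> xi; rewrite /sqnorm (bigD1 i) //= ltr_pwDl ?exprn_even_gt0 //.
by apply: sumr_ge0 => j _; apply: sqr_ge0.
Qed.

Lemma sqnorm_neq0 x : sqnorm x != 0 -> exists i, x i != 0.
Proof.
move=> nx; apply/existsP; apply: contraNT nx => /existsPn x0.
by rewrite /sqnorm big1 // => i _; move/negPn/eqP: (x0 i) => ->; rewrite expr0n.
Qed.

Lemma qform_scale A x c : qform A (fun i => c * x i) = c ^+ 2 * qform A x.
Proof.
rewrite /qform big_distrr /=; apply: eq_bigr => i _.
rewrite /mulv [in LHS](eq_bigr (fun j => c * (A i j * x j))).
  by rewrite -big_distrr /=; ring.
by move=> j _; ring.
Qed.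

Lemma sqnorm_scale x c : sqnorm (fun i => c * x i) = c ^+ 2 * sqnorm x.
Proof. by rewrite /sqnorm big_distrr /=; apply: eq_bigr => i _; rewrite exprMn. Qed.

(** The unit sphere is compact and the form continuous, so a maximum exists; homogeneity of degree
    two carries the bound from unit vectors to all [y]. *)
Lemma rayleigh_attained A : (0 < n)%N ->
  exists2 x, sqnorm x = 1 & forall y, qform A y <= qform A x * sqnorm y.
Proof.
move=> n0.
pose E : set 'rV[R]_n := [set v : 'rV[R]_n | sqnorm (v ord0) = 1]%classic.
have cE i : continuous (fun v : 'rV[R]_n => v ord0 i).
  exact: coord_continuous.
have csq : continuous (fun v : 'rV[R]_n => sqnorm (v ord0)).
  apply: continuous_big => [|i _ v]; first exact: add_continuous.
  by apply: cvg_trans (cvgM (cE i v) (cE i v)); under eq_fun do rewrite expr2.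
have cq : continuous (fun v : 'rV[R]_n => qform A (v ord0)).
  apply: continuous_big => [|i _ v]; first exact: add_continuous.
  apply: (cvgM (cE i v)); move: v; rewrite /mulv.
  apply: continuous_big => [|j _ w]; first exact: add_continuous.
  exact: (cvgM (@cvg_cst _ _ _ _ _) (cE j w)).
have E0 : (E !=set0)%classic.
  exists (\row_j (j == Ordinal n0)%:R); rewrite /E /=.
  rewrite /sqnorm (bigD1 (Ordinal n0)) //= mxE eqxx expr1n big1 ?addr0 // => j.
  by rewrite mxE => /negbTE ->; rewrite expr0n.
have kE : compact E.
  apply: bounded_closed_compact.
    exists 1; split; first exact: num_real.
    (* The norm on row vectors is the largest absolute entry, and each entry is at most 1 in
       absolute value on the sphere. *)
    move=> M M1 v Ev; rewrite /= /Num.Def.normr /= mx_normrE.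
    apply: bigmax_le => [|[i j] _ /=]; first by apply: ltW; lra.
    rewrite (ord1 i); apply: le_trans (ltW M1).
    rewrite -(ler_pXn2r (n := 2)) ?nnegrE // expr1n -Ev /sqnorm real_normK ?num_real //.
    by rewrite (bigD1 j) //= lerDl; apply: sumr_ge0 => k _; apply: sqr_ge0.
  have -> : E = ((fun v : 'rV[R]_n => sqnorm (v ord0)) @^-1` [set 1])%classic by [].
  by move/continuous_closedP: csq; apply; exact: closed_eq.
have [v] := EVT_max_rV E0 kE (continuous_subspaceT cq).
rewrite inE => Ev mv; exists (v ord0) => // y.
have [y0|/negP/negP ny] := boolP (sqnorm y == 0).
  rewrite (eqP y0) mulr0 /qform big1 // => i _.
  suff -> : y i = 0 by rewrite mul0r.
  by apply/eqP; apply: contraTT y0 => /sqnorm_gt0; rewrite lt_def => /andP[].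
have py : 0 < sqnorm y by rewrite lt_def ny sqnorm_ge0.
pose c := (Num.sqrt (sqnorm y))^-1.
have c2 : c ^+ 2 = (sqnorm y)^-1 by rewrite exprVn sqr_sqrtr // ltW.
have := mv (\row_i (c * y i)).
have -> : (\row_i (c * y i)) ord0 = (fun i => c * y i) by apply: funext => i; rewrite mxE.
rewrite inE /E /= qform_scale.
have -> : (\row_i (c * y i)) ord0 = (fun i => c * y i) by apply: funext => i; rewrite mxE.
rewrite sqnorm_scale c2 mulVf // => /(_ erefl).
by rewrite mulrC ler_pdivrMr.
Qed.

Lemma mulv_perturb A x t k i :
  mulv A (fun j => x j + t * (j == k)%:R) i = mulv A x i + t * A i k.
Proof.
rewrite /mulv (eq_bigr (fun j => A i j * x j + t * (A i j * (j == k)%:R))); last first.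
  by move=> j _; ring.
rewrite big_split /= -big_distrr /=; congr (_ + _ * _).
rewrite (bigD1 k) //= eqxx mulr1 big1 ?addr0 // => j /negbTE ->.
by rewrite mulr0.
Qed.

Lemma sum_delta (g : 'I_n -> R) k : \sum_i (i == k)%:R * g i = g k.
Proof.
by rewrite (bigD1 k) //= eqxx mul1r big1 ?addr0 // => j /negbTE ->; rewrite mul0r.
Qed.

(* First-order condition for the quadratic form [c |x|^2 - x A x] at its zero [x]. *)
Lemma rayleigh_eigen A x c : A^T = A ->
  qform A x = c * sqnorm x -> (forall y, qform A y <= c * sqnorm y) ->
  forall i, mulv A x i = c * x i.
Proof.
move=> sA qx mx k.
(* The nonnegative form evaluated at [x + t e_k]: its constant term vanishes, leaving a linear and a
   quadratic term in [t]. *)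
have ineq t : 2 * t * (mulv A x k - c * x k) <= t ^+ 2 * (c - A k k).
  have := mx (fun j => x j + t * (j == k)%:R).
  have -> : sqnorm (fun j => x j + t * (j == k)%:R) =
     sqnorm x + 2 * t * x k + t ^+ 2.
    rewrite /sqnorm (eq_bigr (fun j => x j ^+ 2 + (j == k)%:R * (2 * t * x j + t ^+ 2))).
      by rewrite big_split /= sum_delta addrA.
    by move=> j _; case: eqP => _ /=; ring.
  have -> : qform A (fun j => x j + t * (j == k)%:R) =
     qform A x + 2 * t * mulv A x k + t ^+ 2 * A k k.
    rewrite /qform (eq_bigr (fun j => x j * mulv A x j + t * (A k j * x j) +
       (j == k)%:R * (t * (mulv A x j + t * A j k)))).
      rewrite big_split /= big_split /= -big_distrr /= sum_delta /mulv; ring.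
    have sAE j : A k j = A j k by rewrite -{1}sA mxE.
    by move=> j _; rewrite mulv_perturb sAE; ring.
  rewrite qx; lra.
set g := mulv A x k - c * x k in ineq; set d := c - A k k in ineq.
suff : g = 0 by rewrite /g; lra.
clearbody g d; have d0 : 0 <= d by have := ineq 1; have := ineq (-1); lra.
(* This [t] turns the inequality into [2 g^2 (d + 1) <= g^2 d], which forces [g = 0]; the [+ 1]
   keeps the denominator nonzero when [d = 0]. *)
have := ineq (g / (d + 1)).
have d1 : 0 < d + 1 by lra.
have dn0 : d + 1 != 0 by rewrite gt_eqF.
have -> : 2 * (g / (d + 1)) * g = (2 * g ^+ 2 * (d + 1)) / (d + 1) ^+ 2 by field.
have -> : (g / (d + 1)) ^+ 2 * d = (g ^+ 2 * d) / (d + 1) ^+ 2 by field.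
rewrite ler_pM2r ?invr_gt0 ?exprn_gt0 // => h.
have g2 : g ^+ 2 <= 0 by have := mulr_ge0 (sqr_ge0 g) d0; lra.
by apply/eqP; rewrite -sqrf_eq0 eq_le g2 sqr_ge0.
Qed.

(** [eigenvalue] speaks of row vectors; symmetry of [A] lets them be read as columns. *)
Lemma eigenvalue_mulv A c : A^T = A ->
  eigenvalue A c <-> exists2 x, (exists i, x i != 0) & forall i, mulv A x i = c * x i.
Proof.
move=> sA; have sAE i j : A i j = A j i by rewrite -{1}sA mxE.
split=> [/eigenvalueP[v vA v0]|[x [i xi] xA]].
  exists (v ord0).
    by apply/existsP; apply: contraNT v0 => /existsPn v0; apply/eqP/rowP => i;
      rewrite mxE; apply/eqP/negPn/v0.
  move=> i; have := congr1 (fun M : 'rV[R]_n => M ord0 i) vA; rewrite !mxE => <-.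
  by apply: eq_bigr => j _; rewrite sAE mulrC.
apply/eigenvalueP; exists (\row_i x i).
  apply/rowP => j; rewrite !mxE -xA; apply: eq_bigr => l _.
  by rewrite mxE sAE mulrC.
by apply: contraNneq xi => /(congr1 (fun M : 'rV[R]_n => M ord0 i)); rewrite !mxE => ->.
Qed.

(** The maximum of the form on the sphere is an eigenvalue by the first-order condition and bounds
    every eigenvalue, so it is the supremum defining [lambda1]. *)
Lemma lambda1_max A : (0 < n)%N -> A^T = A ->
  exists2 x, sqnorm x = 1 &
    qform A x = lambda1 A /\ forall y, qform A y <= lambda1 A * sqnorm y.
Proof.
move=> n0 sA; have [x x1 mx] := rayleigh_attained A n0.
suff -> : lambda1 A = qform A x by exists x.
have ex : eigenvalue A (qform A x).
  apply/eigenvalue_mulv => //; exists x.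
    by apply: sqnorm_neq0; rewrite x1 oner_neq0.
  by apply: rayleigh_eigen => //; rewrite x1 mulr1.
have ub : ubound [set a | eigenvalue A a]%classic (qform A x).
  move=> a /= /eigenvalue_mulv -/(_ sA)[v [i vi] va].
  have := mx v; have -> : qform A v = a * sqnorm v.
    rewrite /qform /sqnorm big_distrr /=; apply: eq_bigr => j _.
    by rewrite va; ring.
  by rewrite ler_pM2r // (sqnorm_gt0 vi).
apply/eqP; rewrite eq_le; apply/andP; split.
  by apply: ge_sup => //; exists (qform A x).
by apply: ub_le_sup => //; exists (qform A x).
Qed.

Lemma lambda1_ge_rayleigh A y : (0 < n)%N -> A^T = A -> qform A y <= lambda1 A * sqnorm y.
Proof. by move=> n0 sA; have [x _ []] := lambda1_max n0 sA. Qed.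

(** Collatz-Wielandt bound: for a top eigenvector [x], pairing [|x|] with [y] gives [lambda1 <|x|,
    y> <= <A|x|, y> = <|x|, A y> <= c <|x|, y>], and [<|x|, y>] is positive. *)
Lemma lambda1_le_positive A y c : (0 < n)%N -> A^T = A ->
  (forall i j, 0 <= A i j) -> (forall i, 0 < y i) ->
  (forall i, mulv A y i <= c * y i) -> lambda1 A <= c.
Proof.
move=> n0 sA A0 y0 yc; have [x x1 [qx mx]] := lambda1_max n0 sA.
have ex : forall i, mulv A x i = lambda1 A * x i.
  by apply: rayleigh_eigen => //; rewrite x1 mulr1.
have [|k xk] := @sqnorm_neq0 x; first by rewrite x1 oner_neq0.
have sAE i j : A i j = A j i by rewrite -{1}sA mxE.
have p : 0 < \sum_i `|x i| * y i.
  rewrite (bigD1 k) //= ltr_pwDl ?mulr_gt0 ?normr_gt0 //.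
  by apply: sumr_ge0 => j _; rewrite mulr_ge0 // ltW.
rewrite -(ler_pM2r p) !big_distrr /=.
apply: (@le_trans _ _ (\sum_i mulv A (fun j => `|x j|) i * y i)).
  apply: ler_sum => i _; rewrite mulrA ler_pM2r //.
  apply: (@le_trans _ _ `|lambda1 A * x i|).
    by rewrite normrM ler_wpM2r // ler_norm.
  rewrite -ex; apply: le_trans (ler_norm_sum _ _ _) _.
  by apply: ler_sum => j _; rewrite normrM (ger0_norm (A0 i j)).
rewrite (eq_bigr (fun i => \sum_j (A j i * y i) * `|x j|)); last first.
  by move=> i _; rewrite big_distrl /=; apply: eq_bigr => j _; rewrite sAE; ring.
rewrite exchange_big /=; apply: ler_sum => j _.
rewrite -big_distrl /=; have := yc j; rewrite /mulv => h.
by rewrite [X in _ <= X]mulrCA mulrC ler_wpM2l.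
Qed.

(** Taking absolute values of a maximiser does not decrease the form, so [z = |x|] is again an
    eigenvector; a zero entry of [z] would contradict its own row of the eigenvalue equation, where
    every off-diagonal coefficient is positive. *)
Lemma perron_vector A : (1 < n)%N -> A^T = A ->
  (forall i j, 0 <= A i j) -> (forall i j, i != j -> 0 < A i j) ->
  exists2 x, (forall i, 0 < x i) & qform A x = lambda1 A * sqnorm x.
Proof.
move=> n1 sA A0 Ap; have n0 := ltnW n1; have [x x1 [qx mx]] := lambda1_max n0 sA.
pose z i := `|x i|.
have z1 : sqnorm z = 1.
  by rewrite -x1; apply: eq_bigr => i _; rewrite real_normK ?num_real.
have qz : qform A z = lambda1 A * sqnorm z.
  apply/eqP; rewrite eq_le mx /= z1 mulr1 -qx; apply: ler_sum => i _.
  apply: le_trans (ler_norm _) _; rewrite normrM ler_wpM2l //.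
  apply: le_trans (ler_norm_sum _ _ _) _.
  by apply: ler_sum => j _; rewrite normrM (ger0_norm (A0 i j)).
exists z => // i; rewrite lt_def normr_ge0 andbT.
have ez := rayleigh_eigen sA qz mx.
have [|k xk] := @sqnorm_neq0 x; first by rewrite x1 oner_neq0.
apply/negP => /eqP zi.
have ik : i != k by apply: contraNneq xk => <-; rewrite -normr_eq0; apply/eqP.
have := ez i; rewrite zi mulr0 => s0.
have : 0 < mulv A z i; last by rewrite s0 ltxx.
have zk : 0 < z k by rewrite normr_gt0.
rewrite /mulv (bigD1 k) //= ltr_pwDl ?mulr_gt0 ?Ap //.
by apply: sumr_ge0 => j _; rewrite mulr_ge0 ?normr_ge0.
Qed.

(** With [z] the Perron vector of [A] relabelled by [f], the terms [z_i (D_ij - A_f(i)f(j)) z_j] are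
    nonnegative and their sum is at most [(lambda1 D - lambda1 A) |z|^2 <= 0]. Each term vanishes,
    and [z] is positive. *)
Lemma lambda1_strict_mono A D (f : 'I_n -> 'I_n) : (1 < n)%N -> A^T = A -> D^T = D ->
  (forall i j, 0 <= A i j) -> (forall i j, i != j -> 0 < A i j) ->
  bijective f -> (forall i j, A (f i) (f j) <= D i j) ->
  lambda1 D <= lambda1 A -> forall i j, D i j = A (f i) (f j).
Proof.
move=> n1 sA sD A0 Ap bf AD lDA.
have n0 := ltnW n1; have [x x0 qx] := perron_vector n1 sA A0 Ap.
pose z i := x (f i).
have term0 i j : 0 <= z i * ((D i j - A (f i) (f j)) * z j).
  by rewrite mulr_ge0 ?mulr_ge0 ?subr_ge0 ?AD //; apply/ltW/x0.
have sf (F : 'I_n -> R) : \sum_i F i = \sum_i F (f i).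
  by rewrite (reindex f) //; apply: onW_bij.
have nz : sqnorm z = sqnorm x by rewrite /sqnorm [RHS]sf.
have qE : qform A x = \sum_i \sum_j z i * (A (f i) (f j) * z j).
  by rewrite /qform sf; apply: eq_bigr => i _; rewrite /mulv sf big_distrr.
have := lambda1_ge_rayleigh z n0 sD; rewrite nz => qD.
have s0 i : 0 <= \sum_j z i * ((D i j - A (f i) (f j)) * z j) by apply: sumr_ge0.
have S : \sum_i \sum_j z i * ((D i j - A (f i) (f j)) * z j) = 0.
  apply/eqP; rewrite eq_le; apply/andP; split; last exact: sumr_ge0.
  have -> : \sum_i \sum_j z i * ((D i j - A (f i) (f j)) * z j) = qform D z - qform A x.
    rewrite qE /qform -sumrB; apply: eq_bigr => i _.
    by rewrite /mulv big_distrr /= -sumrB; apply: eq_bigr => j _; ring.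
  rewrite qx subr_le0; apply: le_trans qD _; rewrite ler_wpM2r ?sqnorm_ge0 //.
move=> i j; move/eqP: S; rewrite psumr_eq0 // => /allP/(_ i).
rewrite mem_index_enum => /(_ isT) /=; rewrite psumr_eq0 //.
move=> /allP/(_ j); rewrite mem_index_enum => /(_ isT) /=.
by rewrite !mulf_eq0 !(gt_eqF (x0 _)) orbF /= subr_eq0 => /eqP.
Qed.

End Rayleigh.

(** * Distances through bounded reachability *)

Section Distance.
Variables (n : nat) (e : rel 'I_n).

(** [find] returns [n] when no step count below [n] succeeds, hence the bound [d <= n]. *)
Lemma leq_dist d u v : d <= n -> (forall d', d' < d -> ~~ reach e d' u v) ->
  d <= dist e u v.
Proof.
move=> dn nr; rewrite leqNgt; apply/negP => lt; have ltn := leq_trans lt dn.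
have := nth_find 0 (a := fun d => reach e d u v) (s := iota 0 n).
rewrite has_find size_iota => /(_ ltn); rewrite nth_iota // add0n.
by apply/negP/nr.
Qed.

Lemma dist_leq d u v : d < n -> reach e d u v -> dist e u v <= d.
Proof.
move=> dn r; rewrite leqNgt; apply/negP => /(before_find 0).
by rewrite nth_iota // add0n r.
Qed.

Lemma dist_refl u : dist e u u = 0.
Proof.
apply/eqP; rewrite -leqn0; apply: dist_leq; last exact: eqxx.
exact: leq_trans (ltn_ord u).
Qed.

Lemma reach1 u v : reach e 1 u v = (u == v) || e u v.
Proof.
rewrite /=; congr (_ || _); apply/existsP/idP => [[w /andP[/eqP -> //]]|euv].
by exists u; rewrite eqxx.
Qed.

Lemma dist_gt0 u v : u != v -> 0 < dist e u v.
Proof.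
move=> uv; apply: leq_dist; first exact: leq_trans (ltn_ord u).
by case.
Qed.

Lemma dist_gt1 u v : 1 < n -> u != v -> ~~ e u v -> 1 < dist e u v.
Proof.
move=> n1 uv nuv; apply: leq_dist => // -[|[|//]] _ //.
by rewrite reach1 negb_or uv.
Qed.

(** Recovers the graph from its distance matrix, so that equal matrices give isomorphic graphs. *)
Lemma adj_dist u v : 1 < n -> irreflexive e -> e u v = (dist e u v == 1).
Proof.
move=> n1 ie; have [-> | uv] := eqVneq u v; first by rewrite ie dist_refl.
have [euv|nuv] := boolP (e u v); last by rewrite gtn_eqF // dist_gt1.
by rewrite eq_sym eqn_leq dist_gt0 // dist_leq // reach1 euv orbT.
Qed.

Lemma reach_sub c d u v : c <= d -> reach e c u v -> reach e d u v.
Proof.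
by elim: d => [|d IH]; [case: c | rewrite leq_eqVlt => /predU1P[-> //|/IH h /h /= ->]].
Qed.

Lemma reach_trans c d u v w : reach e c u v -> reach e d v w -> reach e (c + d) u w.
Proof.
move=> uv; elim: d w => [|d IH] w; first by rewrite addn0 => /eqP <-.
rewrite addnS /= => /orP[/IH -> //|/existsP[y /andP[/IH uy yw]]].
by apply/orP; right; apply/existsP; exists y; rewrite uy.
Qed.

Lemma reach_sym d : symmetric e -> symmetric (reach e d).
Proof.
move=> se; suff sub u v : reach e d u v -> reach e d v u by move=> u v; apply/idP/idP; apply: sub.
elim: d u v => [|d IH] u v; first by rewrite /= eq_sym.
case/orP => [/IH|/existsP[w /andP[/IH wu ewv]]]; first exact: reach_sub.
rewrite -add1n; apply: reach_trans wu.
by rewrite reach1 se ewv orbT.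
Qed.

Lemma dist_sym u v : symmetric e -> dist e u v = dist e v u.
Proof. by move=> se; apply: eq_find => d; apply: reach_sym. Qed.

End Distance.

(** * Extremal graphs with a dominating set: distances and relabelling *)

Section Core.
Variable n : nat.
Implicit Types (S I : {set 'I_n}) (e : rel 'I_n).

(* [K_s \/ (K_{n-s-i} u i K_1)] with [S] the set of [s] dominating vertices and
   [I] the set of [i] vertices left isolated by the removal of [S]. *)
Definition core_graph S I : rel 'I_n :=
  fun x y => (x != y) && [|| x \in S, y \in S | (x \notin I) && (y \notin I)].

(** Closed form of the distance in [core_graph S I] for nonempty [S] disjoint from [I] and [n > 2]:
    a vertex of [S] is adjacent to all others, so the diameter is at most two. *)
Definition core_dist S I (x y : 'I_n) : nat :=
  if x == y then 0 else if core_graph S I x y then 1 else 2.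

Lemma core_graphC S I : symmetric (core_graph S I).
Proof.
by move=> x y; rewrite /core_graph eq_sym orbCA [(x \notin I) && _]andbC.
Qed.

Lemma core_distC S I x y : core_dist S I x y = core_dist S I y x.
Proof. by rewrite /core_dist eq_sym core_graphC. Qed.

Lemma core_graph_dist S I x y : core_graph S I x y = (core_dist S I x y == 1).
Proof.
by rewrite /core_dist; case: (eqVneq x y) => [->|_]; [rewrite /core_graph eqxx | case: ifP].
Qed.

(** The hypothesis makes [e] a subgraph of the core graph up to loops, so pairs not adjacent there
    are at distance at least two in [e]. *)
Lemma core_dist_le_dist S I e x y : 1 < n -> symmetric e ->
  (forall u v, u \in I -> v \notin S -> ~~ e u v) ->
  core_dist S I x y <= dist e x y.
Proof.
move=> n1 se sep; rewrite /core_dist; case: (eqVneq x y) => // xy.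
case: ifPn => [_|]; first exact: dist_gt0.
rewrite /core_graph xy /= !negb_or => /and3P[xS yS]; rewrite negb_and !negbK => xyI.
apply: dist_gt1 => //; case/orP: xyI => h; last rewrite se; exact: sep.
Qed.

Lemma dist_core_graph S I x y : 2 < n -> [disjoint S & I] -> S != finset.set0 ->
  dist (core_graph S I) x y = core_dist S I x y.
Proof.
move=> n2 dSI /set0Pn[z zS]; have n1 := ltnW n2.
apply/eqP; rewrite eqn_leq; apply/andP; split; last first.
  apply: core_dist_le_dist => //; first exact: core_graphC.
  move=> u v uI vS; rewrite /core_graph (negbTE vS) uI /= orbF.
  by rewrite (disjointFl dSI uI) andbF.
rewrite /core_dist; case: eqVneq => [->|xy]; first by rewrite dist_refl.
case: ifPn => [h|]; first by rewrite dist_leq // reach1 h orbT.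
rewrite /core_graph xy /= !negb_or => /and3P[xS yS _].
(* A walk of at most two steps through the dominating vertex [z]; [2 < n] keeps this length within
   the range searched by [dist]. *)
apply: dist_leq => //; apply: (@reach_trans _ _ 1 1 _ z).
  by rewrite reach1 /core_graph zS orbT andbT orbN.
by rewrite reach1 /core_graph zS andbT orbN.
Qed.

(** List the vertices with the first set first, the second next and the others last; matching equal
    positions of two such lists respects the blocks, which the position alone determines. *)
Lemma set_pair_bijection S I S' I' : [disjoint S & I] -> [disjoint S' & I'] ->
  #|S| = #|S'| -> #|I| = #|I'| ->
  exists2 f : 'I_n -> 'I_n, bijective f &
    forall i, (f i \in S') = (i \in S) /\ (f i \in I') = (i \in I).
Proof.
move=> dSI dSI' cS cI.
pose L (A B : {set 'I_n}) := enum A ++ enum B ++ enum (~: (A :|: B)).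
have memL A B i : i \in L A B.
  by rewrite !mem_cat !mem_enum !inE; case: (i \in A); case: (i \in B).
have uL (A B : {set 'I_n}) : [disjoint A & B] -> uniq (L A B).
  move=> dAB; rewrite !cat_uniq !enum_uniq /= andbT; apply/andP; split.
    apply/hasPn => i; rewrite mem_cat !mem_enum !inE => /orP[iB|].
      by rewrite (disjointFl dAB iB).
    by rewrite negb_or => /andP[].
  by apply/hasPn => i; rewrite !mem_enum !inE negb_or => /andP[].
have sz (A B : {set 'I_n}) : [disjoint A & B] -> size (L A B) = n.
  move=> dAB; rewrite -[RHS]card_ord -(card_uniqP (uL A B dAB)).
  by apply: eq_card => i; rewrite memL.
have inA (A B : {set 'I_n}) i : [disjoint A & B] -> (i \in A) = (index i (L A B) < #|A|).
  move=> dAB; rewrite /L index_cat mem_enum; case: ifPn => iA.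
    by rewrite cardE index_mem mem_enum.
  by rewrite cardE ltnNge leq_addr.
have inAB (A B : {set 'I_n}) i : [disjoint A & B] ->
    (i \in A) || (i \in B) = (index i (L A B) < #|A| + #|B|).
  move=> dAB; rewrite /L catA index_cat mem_cat !mem_enum; case: ifPn => iA.
    by rewrite !cardE -size_cat index_mem mem_cat !mem_enum.
  by rewrite !cardE -size_cat ltnNge leq_addr.
(* For disjoint pairs both lists have length [n], so the default [i] of [nth] is never returned. *)
pose F (A B A' B' : {set 'I_n}) (i : 'I_n) : 'I_n := nth i (L A' B') (index i (L A B)).
have FK (A B A' B' : {set 'I_n}) : [disjoint A & B] -> [disjoint A' & B'] ->
    cancel (F A B A' B') (F A' B' A B).
  move=> d d' i; rewrite /F.
  have lt : index i (L A B) < n by rewrite -[X in _ < X](sz A B d) index_mem.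
  by rewrite index_uniq ?uL ?sz // nth_index.
exists (F S I S' I'); first by exists (F S' I' S I); apply: FK.
move=> i.
have E : index (F S I S' I' i) (L S' I') = index i (L S I).
  by rewrite /F index_uniq ?uL // sz // -[X in _ < X](sz S I dSI) index_mem.
have mS : (F S I S' I' i \in S') = (i \in S).
  by rewrite (inA S' I') // E -cS -(inA S I).
split=> //.
have := inAB S' I' (F S I S' I' i) dSI'; rewrite E -cS -cI -(inAB S I) // mS.
have := disjointFr dSI (x := i); have := disjointFr dSI' (x := F S I S' I' i).
by rewrite mS; case: (i \in S) => // /(_ isT) -> /(_ isT) ->.
Qed.

Lemma core_graph_map S I S' I' (f : 'I_n -> 'I_n) : injective f ->
  (forall i, (f i \in S') = (i \in S) /\ (f i \in I') = (i \in I)) ->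
  forall x y, core_graph S' I' (f x) (f y) = core_graph S I x y.
Proof.
move=> fI h x y; rewrite /core_graph (inj_eq fI).
by have [-> ->] := h x; have [-> ->] := h y.
Qed.

End Core.

(** * Quotient matrix of the core distance matrix *)

Section CoreMatrix.
Local Open Scope ring_scope.
Variables (R : realType) (n : nat).
Implicit Types (S I : {set 'I_n}) (a b d c : R) (D : 'M[R]_n).

Definition core_mx S I : 'M[R]_n := \matrix_(i, j) (core_dist S I i j)%:R.

(** The values [a], [b], [d] belong to [S], the remaining vertices and [I]. For disjoint [S] and [I]
    this partition is equitable for [core_mx], so these vectors are mapped to vectors of the same
    kind. *)
Definition class_fun S I a b d (i : 'I_n) : R :=
  if i \in S then a else if i \in I then d else b.

Lemma core_mx_tr S I : (core_mx S I)^T = core_mx S I.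
Proof. by apply/matrixP => i j; rewrite !mxE core_distC. Qed.

Lemma sum_class_fun S I a b d : [disjoint S & I] ->
  \sum_i class_fun S I a b d i =
  #|S|%:R * a + (n - (#|S| + #|I|))%:R * b + #|I|%:R * d.
Proof.
move=> dSI; rewrite (bigID (mem S)) /= (eq_bigr (fun _ => a)); last first.
  by move=> i; rewrite /class_fun => ->.
rewrite sumr_const -[RHS]addrA mulr_natl; congr (_ + _).
rewrite (bigID (mem I)) /= (eq_bigr (fun _ => d)); last first.
  by move=> i /andP[iS iI]; rewrite /class_fun (negbTE iS) iI.
rewrite (eq_bigl (mem I)); last first.
  by move=> i /=; case iI : (i \in I); rewrite ?andbF // (disjointFl dSI iI).
rewrite sumr_const addrC !mulr_natl; congr (_ + _).
rewrite (eq_bigr (fun _ => b)); last first.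
  by move=> i /andP[iS iI]; rewrite /class_fun (negbTE iS) (negbTE iI).
rewrite (eq_bigl (mem (~: (S :|: I)))); last first.
  by move=> i /=; rewrite !inE negb_or.
rewrite sumr_const; congr (_ *+ _).
have <- : #|S :|: I| = (#|S| + #|I|)%N by rewrite cardsU (disjoint_setI0 dSI) cards0 subn0.
by rewrite cardsCs finset.setCK card_ord.
Qed.

Lemma class_funM S I a b d a' b' d' i :
  class_fun S I a b d i * class_fun S I a' b' d' i =
  class_fun S I (a * a') (b * b') (d * d') i.
Proof. by rewrite /class_fun; case: ifP => //; case: ifP. Qed.

Lemma mulv_core S I a b d : [disjoint S & I] ->
  let s := #|S|%:R in let t := (n - (#|S| + #|I|))%:R in let r := #|I|%:R in
  mulv (core_mx S I) (class_fun S I a b d) =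
  class_fun S I (s * a + t * b + r * d - a) (s * a + t * b + 2 * r * d - b)
    (s * a + 2 * t * b + 2 * r * d - 2 * d).
Proof.
move=> dSI s t r; apply: funext => i; rewrite /mulv.
set x := class_fun S I a b d.
(* Row [i] is constant on each class except on the diagonal, where the class value (2 on [I],
   otherwise 1) must be subtracted again. *)
have E j : core_mx S I i j * x j =
    (class_fun S I 1 (if i \in S then 1 else if i \in I then 2 else 1)
       (if i \in S then 1 else 2) j) * x j
    - (j == i)%:R * ((if i \in S then 1 else if i \in I then 2 else 1) * x j).
  rewrite mxE /core_dist /core_graph [j == i]eq_sym; case: eqVneq => [<-|ij] /=.
    by rewrite /x /class_fun; case: (i \in S); case: (i \in I) => /=; ring.
  rewrite mul0r subr0; congr (_ * _); rewrite /class_fun.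
  by case: (i \in S); case: (j \in S) => //=; case: (j \in I) => //=; case: (i \in I).
rewrite (eq_bigr _ (fun j _ => E j)) sumrB sum_delta.
rewrite (eq_bigr _ (fun j _ => class_funM _ _ _ _ _ _ _ _ j)) sum_class_fun //.
rewrite /x /class_fun -/s -/t -/r.
by case: (i \in S); [ring | case: (i \in I); ring].
Qed.

Lemma core_lambda1_le S I a b d c : (0 < n)%N -> [disjoint S & I] ->
  let s := #|S|%:R in let t := (n - (#|S| + #|I|))%:R in let r := #|I|%:R in
  0 < a -> 0 < b -> 0 < d ->
  s * a + t * b + r * d - a <= c * a ->
  s * a + t * b + 2 * r * d - b <= c * b ->
  s * a + 2 * t * b + 2 * r * d - 2 * d <= c * d ->
  lambda1 (core_mx S I) <= c.
Proof.
move=> n0 dSI s t r a0 b0 d0 ha hb hd.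
apply: (lambda1_le_positive (y := class_fun S I a b d)) => //.
- exact: core_mx_tr.
- by move=> i j; rewrite mxE.
- by move=> i; rewrite /class_fun; case: ifP => //; case: ifP.
by move=> i; rewrite mulv_core // /class_fun; case: ifP => //; case: ifP.
Qed.

(** The test vector is nonnegative, so entrywise domination by [D] can only raise its Rayleigh
    quotient. *)
Lemma core_lambda1_gt S I D a b d c : (0 < n)%N -> [disjoint S & I] -> D^T = D ->
  (forall i j, core_mx S I i j <= D i j) ->
  let s := #|S|%:R in let t := (n - (#|S| + #|I|))%:R in let r := #|I|%:R in
  0 <= a -> 0 <= b -> 0 <= d ->
  c * (s * a ^+ 2 + t * b ^+ 2 + r * d ^+ 2) <
    s * (a * (s * a + t * b + r * d - a)) + t * (b * (s * a + t * b + 2 * r * d - b)) +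
    r * (d * (s * a + 2 * t * b + 2 * r * d - 2 * d)) ->
  c < lambda1 D.
Proof.
move=> n0 dSI sD WD s t r a0 b0 d0 lt.
pose x := class_fun S I a b d.
have x0 i : 0 <= x i by rewrite /x /class_fun; case: ifP => //; case: ifP.
have nx : sqnorm x = s * a ^+ 2 + t * b ^+ 2 + r * d ^+ 2.
  by rewrite -sum_class_fun //; apply: eq_bigr => i _; rewrite expr2 class_funM.
have qx : qform (core_mx S I) x <= qform D x.
  apply: ler_sum => i _; apply: ler_wpM2l => //.
  by apply: ler_sum => j _; apply: ler_wpM2r.
have := le_trans qx (lambda1_ge_rayleigh x n0 sD).
rewrite /qform mulv_core // (eq_bigr _ (fun j _ => class_funM _ _ _ _ _ _ _ _ j)).
rewrite sum_class_fun // -/s -/t -/r => le; have := lt_le_trans lt le; rewrite nx.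
rewrite ltNge -ltNge => h; rewrite ltNge; apply: contraTN h => le'.
by rewrite -leNgt ler_wpM2r // -nx sqnorm_ge0.
Qed.

End CoreMatrix.

(** * From barriers to core graphs, and the reference graphs as core graphs *)

Lemma barrier_core n (e : rel 'I_n) k (S : {set 'I_n}) : 0 < k -> ~~ odd k ->
  k_barrier k e S ->
  exists I : {set 'I_n}, [/\ #|I| = #|S|, [disjoint S & I] &
    forall u v, u \in I -> v \notin S -> ~~ e u v].
Proof.
move=> k0 ke /(_ finset.set0); rewrite /bt_value (negbTE ke) cards0 => le.
(* The empty set has value [k i(G) >= 0], so the barrier value is nonnegative and [k > 0]
   cancels. *)
have cS : #|S| <= iso_count e S by nia.
have [I IJ cI] : exists2 I : {set 'I_n},
    I \subset [set x | (x \notin S) && [forall y, ~~ del_rel e S x y]] & #|I| = #|S|.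
  rewrite /iso_count in cS; set J := [set x | _ ] in cS *.
  (* Keeping exactly [#|S|] of the isolated vertices leaves a family with the single parameter
     [s]. *)
  exists [set x in take #|S| (enum J)].
    by apply/fintype.subsetP => x; rewrite finset.inE => /mem_take; rewrite mem_enum.
  rewrite cardsE (card_uniqP _) ?take_uniq ?enum_uniq //.
  by rewrite size_takel // -cardE.
have IP u : u \in I -> u \notin S /\ forall v, v \notin S -> ~~ e u v.
  move/(fintype.subsetP IJ); rewrite finset.inE => /andP[uS /forallP h]; split=> // v vS.
  by have := h v; rewrite /del_rel uS vS.
exists I; split=> //.
  by rewrite disjoint_sym finset.disjoints_subset; apply/fintype.subsetP => u /IP[uS _]; rewrite finset.inE.
by move=> u v /IP[_ h]; apply: h.
Qed.

Lemma join_core_graph n : join_K1_Kn2_K1 n =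
  core_graph [set x : 'I_n | (x : nat) == 0] [set x : 'I_n | (x : nat) == n.-1].
Proof. by apply: funext => x; apply: funext => y; rewrite /core_graph !finset.inE. Qed.

Lemma S_nk_core_graph n k : S_nk n k =
  core_graph [set x : 'I_n | (x : nat) < k] [set x : 'I_n | ~~ ((x : nat) < k)].
Proof.
apply: funext => x; apply: funext => y; rewrite /core_graph !finset.inE !negbK.
by rewrite /S_nk; case: ltnP; case: ltnP.
Qed.

Lemma card_ord_lt n k : k <= n -> #|[set x : 'I_n | (x : nat) < k]| = k.
Proof.
move=> kn; rewrite cardsE -sum1_card; rewrite -[RHS](card_ord k) -sum1_card.
by rewrite (big_ord_widen n (fun=> 1)).
Qed.

Lemma disjoint_setC n (A : {set 'I_n}) : [disjoint A & ~: A].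
Proof. by rewrite finset.disjoints_subset finset.setCK. Qed.

Lemma S_nk_coreC n k :
  [set x : 'I_n | ~~ ((x : nat) < k)] = ~: [set x : 'I_n | (x : nat) < k].
Proof. by apply/setP => x; rewrite !finset.inE. Qed.

Lemma card_join_core n : 1 < n ->
  #|[set x : 'I_n | (x : nat) == 0]| = 1 /\ #|[set x : 'I_n | (x : nat) == n.-1]| = 1.
Proof.
move=> n1; have n0 := ltnW n1.
have h k : k < n -> #|[set x : 'I_n | (x : nat) == k]| = 1.
  move=> kn; rewrite -(cards1 (Ordinal kn)); apply: eq_card => x.
  by rewrite !finset.inE -val_eqE.
by split; apply: h; rewrite // ltn_predL.
Qed.

Lemma disjoint_join_core n : 1 < n ->
  [disjoint [set x : 'I_n | (x : nat) == 0] & [set x : 'I_n | (x : nat) == n.-1]].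
Proof.
move=> n1; rewrite finset.disjoints_subset; apply/fintype.subsetP => x.
by rewrite !finset.inE => /eqP ->; rewrite eq_sym -lt0n; lia.
Qed.

(** * Bounds on the distance spectral radius *)

Section Spectral.
Local Open Scope ring_scope.
Variables (R : realType) (n : nat).
Implicit Types (S I : {set 'I_n}) (e : rel 'I_n) (c : R).

Lemma dist_matrix_tr e : symmetric e -> (dist_matrix R e)^T = dist_matrix R e.
Proof. by move=> se; apply/matrixP => i j; rewrite !mxE dist_sym. Qed.

Lemma dist_matrix_core S I : (2 < n)%N -> [disjoint S & I] -> S != finset.set0 ->
  dist_matrix R (core_graph S I) = core_mx R S I.
Proof. by move=> n2 d S0; apply/matrixP => i j; rewrite !mxE dist_core_graph. Qed.

(** After relabelling, the distance matrix of [e] dominates that of the reference graph entrywise;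
    strict monotonicity makes them equal, and adjacency is distance one. *)
Lemma core_graph_extremal S I S' I' e : (2 < n)%N -> symmetric e -> irreflexive e ->
  (forall u v, u \in I -> v \notin S -> ~~ e u v) ->
  [disjoint S & I] -> [disjoint S' & I'] -> S' != finset.set0 ->
  #|S| = #|S'| -> #|I| = #|I'| ->
  lambda1 (dist_matrix R e) <= lambda1 (dist_matrix R (core_graph S' I')) ->
  graph_iso e (core_graph S' I').
Proof.
move=> n2 se ie sep d d' S0 cS cI; have n1 := ltnW n2.
rewrite dist_matrix_core // => le.
have [f bf fP] := set_pair_bijection d d' cS cI.
exists f; split=> // x y.
have E u v : core_dist S' I' (f u) (f v) = core_dist S I u v.
  by rewrite /core_dist (bij_eq bf) (core_graph_map (bij_inj bf) fP).
have := @lambda1_strict_mono R n (core_mx R S' I') (dist_matrix R e) f n1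
  (core_mx_tr R S' I') (dist_matrix_tr se) _ _ bf _ le x y.
rewrite !mxE => h; apply/idP/idP; rewrite core_graph_dist (adj_dist _ _ n1 ie);
  suff -> : dist e x y = core_dist S' I' (f x) (f y) by [].
all: apply/eqP; rewrite -(eqr_nat R); apply/eqP; apply: h => i j; rewrite !mxE ?ler0n //.
all: try by rewrite E ler_nat core_dist_le_dist.
all: by rewrite ltr0n /core_dist => /negbTE ->; case: ifP.
Qed.

(* The cubic is the characteristic polynomial of the quotient matrix on the three vertex
   classes; the vector below solves its first and third rows exactly. *)
Lemma join_lambda1_le c : (2 < n)%N -> 1 < c ->
  0 <= c ^+ 3 - (n%:R - 3) * c ^+ 2 - (5 * n%:R - 9) * c - (3 * n%:R - 5) ->
  lambda1 (dist_matrix R (join_K1_Kn2_K1 n)) <= c.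
Proof.
move=> n2 c1 fc; have n1 := ltnW n2; have [cS cI] := card_join_core n1.
have m0 : (0 : R) < n%:R - 2 by rewrite subr_gt0 ltr_nat.
have c2 : 1 < c ^+ 2 by rewrite exprn_egt1.
rewrite join_core_graph dist_matrix_core ?disjoint_join_core //; last first.
  by rewrite -card_gt0 cS.
apply: (core_lambda1_le (a := (n%:R - 2) * (c + 2)) (b := c ^+ 2 - 1)
    (d := (n%:R - 2) * (2 * c + 1))); rewrite ?disjoint_join_core ?cS ?cI ?natrB //.
- exact: ltnW.
- by rewrite mulr_gt0 //; lra.
- by lra.
- by rewrite mulr_gt0 //; lra.
all: rewrite -subr_ge0.
- by rewrite le_eqVlt; apply/orP; left; apply/eqP; ring.
- by apply: le_trans fc _; rewrite le_eqVlt; apply/orP; left; apply/eqP; ring.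
- by rewrite le_eqVlt; apply/orP; left; apply/eqP; ring.
Qed.

(* The quadratic is the characteristic polynomial of the quotient matrix; the middle class
   is empty, so [b] only has to be large. *)
Lemma S_nk_lambda1_le m c : (1 < m)%N -> n = m.*2 -> m%:R - 1 < c ->
  0 <= c ^+ 2 - (3 * m%:R - 3) * c + (m%:R ^+ 2 - 4 * m%:R + 2) ->
  lambda1 (dist_matrix R (S_nk n m)) <= c.
Proof.
move=> m1 nm cm fc; have mn : (m <= n)%N by rewrite nm; lia.
have M1 : 1 < m%:R :> R by rewrite ltr1n.
have cS := card_ord_lt mn.
have cI : #|~: [set x : 'I_n | ((x : nat) < m)%N]| = m.
  by rewrite cardsCs finset.setCK card_ord cS nm -addnn addnK.
rewrite S_nk_core_graph S_nk_coreC dist_matrix_core ?disjoint_setC //; first last.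
- by rewrite -card_gt0 cS ltnW.
- by rewrite nm; lia.
apply: (core_lambda1_le (a := m%:R) (b := m%:R * m%:R + 2 * m%:R * (c - m%:R + 1))
    (d := c - m%:R + 1)); rewrite ?disjoint_setC ?cS ?cI ?nm -?addnn ?subnn //.
- by rewrite addn_gt0 (ltnW m1).
- by lra.
- by nra.
- by lra.
all: nra.
Qed.

Lemma dist_lambda1_gt S I e c (a b d : R) : (2 < n)%N -> symmetric e ->
  (forall u v, u \in I -> v \notin S -> ~~ e u v) ->
  [disjoint S & I] -> #|I| = #|S| ->
  let s := #|S|%:R in let N := n%:R in
  0 <= a -> 0 <= b -> 0 <= d ->
  c * (s * a ^+ 2 + (N - 2 * s) * b ^+ 2 + s * d ^+ 2) <
    s * (a * (s * a + (N - 2 * s) * b + s * d - a)) +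
    (N - 2 * s) * (b * (s * a + (N - 2 * s) * b + 2 * s * d - b)) +
    s * (d * (s * a + 2 * (N - 2 * s) * b + 2 * s * d - 2 * d)) ->
  c < lambda1 (dist_matrix R e).
Proof.
move=> n2 se sep dSI cI s N a0 b0 d0.
have le : (#|S| + #|I| <= n)%N.
  by have := max_card (mem (S :|: I)); rewrite card_ord cardsU (disjoint_setI0 dSI) cards0 subn0.
(* The bound [le] rules out truncated subtraction, so the hypothesis can be stated as a polynomial
   in real [s] and [N]. *)
have E : N - 2 * s = (n - (#|S| + #|I|))%:R.
  by rewrite natrB // natrD cI /N /s; ring.
rewrite E => h; apply: (core_lambda1_gt (S := S) (I := I) (a := a) (b := b) (d := d)) => //.
- exact: ltnW (ltnW n2).
- exact: dist_matrix_tr.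
- by move=> i j; rewrite !mxE ler_nat core_dist_le_dist // ltnW.
by rewrite cI in h *.
Qed.

End Spectral.

(** * Rational constants separating the spectral radii *)

Section Separation.
Local Open Scope ring_scope.
Variables (R : realType) (n : nat) (e : rel 'I_n) (S I : {set 'I_n}).
Hypotheses (n2 : (2 < n)%N) (se : symmetric e) (dSI : [disjoint S & I]) (cI : #|I| = #|S|).
Hypothesis sep : forall u v, u \in I -> v \notin S -> ~~ e u v.

Lemma double_core_le : (#|S|.*2 <= n)%N.
Proof.
have := max_card (mem (S :|: I)).
by rewrite card_ord cardsU (disjoint_setI0 dSI) cards0 subn0 cI addnn.
Qed.

(* The Rayleigh quotient at the all-ones vector. *)
Lemma dist_lambda1_gt_ones (c : R) :
  let s := #|S|%:R in let N := n%:R in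
  c * N < N ^+ 2 - N + 2 * s * N - 3 * s ^+ 2 - s ->
  c < lambda1 (dist_matrix R e).
Proof.
move=> s N h; apply: (dist_lambda1_gt (a := 1) (b := 1) (d := 1) n2 se sep dSI cI) => //.
by rewrite -/s -/N; lra.
Qed.

Lemma lambda1_join_lt : odd n || (9 < n)%N -> (1 < #|S|)%N ->
  lambda1 (dist_matrix R (join_K1_Kn2_K1 n)) < lambda1 (dist_matrix R e).
Proof.
move=> nP s2; have sn := double_core_le.
suff [c [c1 fc cl]] : exists c : R, [/\ 1 < c,
    0 <= c ^+ 3 - (n%:R - 3) * c ^+ 2 - (5 * n%:R - 9) * c - (3 * n%:R - 5) &
    c < lambda1 (dist_matrix R e)].
  by apply: le_lt_trans cl; apply: join_lambda1_le.
have s2R : 2 <= #|S|%:R :> R by rewrite ler_nat.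
have [n15|n14] := leqP 15 n.
  have n15R : 15 <= n%:R :> R by rewrite ler_nat.
  have snR : 2 * #|S|%:R <= n%:R :> R by rewrite -natrM ler_nat mul2n.
  (* At [c = n + 2] the cubic equals [16 n + 43]. The all-ones condition reads
     [3 s^2 + s + 3 n < 2 s n]; it is concave in [s] and amounts to [n > 14] at both ends [s = 2]
     and [s = n / 2]. *)
  exists (n%:R + 2); split; [lra | lra | apply: dist_lambda1_gt_ones].
  have h1 : 0 <= (#|S|%:R - 2) * (n%:R - 2 * #|S|%:R) :> R by rewrite mulr_ge0; lra.
  have h2 : 0 <= (#|S|%:R - 2) * (n%:R - 15) :> R by rewrite mulr_ge0; lra.
  lra.
have smR : #|S|%:R <= n./2%:R :> R by rewrite ler_nat; lia.
(* Bounds [s^2] linearly on [2 <= s <= n./2], which by concavity reduces the all-ones condition to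
   the two endpoints. *)
have h : 0 <= (#|S|%:R - 2) * (n./2%:R - #|S|%:R) :> R by rewrite mulr_ge0; lra.
have ones (c N M : R) : n%:R = N -> n./2%:R = M -> 1 < c ->
   0 <= c ^+ 3 - (N - 3) * c ^+ 2 - (5 * N - 9) * c - (3 * N - 5) ->
   (0 <= (#|S|%:R - 2) * (M - #|S|%:R) -> #|S|%:R <= M ->
     c * N < N ^+ 2 - N + 2 * #|S|%:R * N - 3 * #|S|%:R ^+ 2 - #|S|%:R) ->
   exists c : R, [/\ 1 < c,
    0 <= c ^+ 3 - (n%:R - 3) * c ^+ 2 - (5 * n%:R - 9) * c - (3 * n%:R - 5) &
    c < lambda1 (dist_matrix R e)].
  move=> nE mE c1 fc cl; exists c; split=> //; first by rewrite nE.
  by apply: dist_lambda1_gt_ones; rewrite nE; apply: cl; rewrite -mE.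
have : n \in [:: 5; 7; 9; 10; 11; 12; 13; 14].
  by move: nP; rewrite !inE; lia.
move=> nI.
have [nE|n5] := eqVneq n 5%N.
  have sE : #|S| = 2%N by lia.
  have nR : n%:R = 5 :> R by rewrite nE.
  (* The all-ones quotient is only [26 / 5], where the cubic is still negative; the weights 2, 3, 3
     give [188 / 35 > 5.36]. *)
  exists (536 / 100); split; [lra | by rewrite nR; lra |].
  apply: (dist_lambda1_gt (a := 2) (b := 3) (d := 3) n2 se sep dSI cI) => //.
  by rewrite sE nR; lra.
case: (boolP (n \in [:: 7; 9; 10; 11])) => [|nI2].
  (* Each constant lies above the largest root of the cubic and below the all-ones quotients for all
     [2 <= s <= n./2]. *)
  rewrite !inE => /or4P[]/eqP nE.
  - by apply: (ones (77 / 10) 7 3); rewrite ?nE //; lra.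
  - by apply: (ones (102 / 10) 9 4); rewrite ?nE //; lra.
  - by apply: (ones (1099 / 100) 10 5); rewrite ?nE //; lra.
  - by apply: (ones (125 / 10) 11 5); rewrite ?nE //; lra.
have : n \in [:: 12; 13; 14] by move: nI n5 nI2; rewrite !inE; lia.
rewrite !inE => /or3P[]/eqP nE.
- by apply: (ones (134 / 10) 12 6); rewrite ?nE //; lra.
- by apply: (ones (149 / 10) 13 6); rewrite ?nE //; lra.
- by apply: (ones (159 / 10) 14 7); rewrite ?nE //; lra.
Qed.

Lemma lambda1_S_nk_lt : ~~ odd n -> (4 <= n <= 8)%N -> (0 < #|S| < n./2)%N ->
  lambda1 (dist_matrix R (S_nk n n./2)) < lambda1 (dist_matrix R e).
Proof.
move=> ne n48 sP.
suff [m [c [m1 nE [cm fc cl]]]] : exists m, exists c : R, [/\ (1 < m)%N, n = m.*2 &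
   [/\ m%:R - 1 < c, 0 <= c ^+ 2 - (3 * m%:R - 3) * c + (m%:R ^+ 2 - 4 * m%:R + 2) &
    c < lambda1 (dist_matrix R e)]].
  have -> : n./2 = m by rewrite nE doubleK.
  by apply: le_lt_trans cl; apply: S_nk_lambda1_le.
(* The constants chosen below slightly exceed the larger roots [(3 + sqrt 17) / 2], [3 + sqrt 10]
   and [(9 + sqrt 73) / 2] of the quadratic for [m = 2, 3, 4]. *)
have : n \in [:: 4; 6; 8] by move: ne n48; rewrite !inE; lia.
rewrite !inE => /or3P[]/eqP nE.
- have sE : #|S| = 1%N by lia.
  exists 2%N, (36 / 10); split=> //; split; [lra | lra |].
  by apply: dist_lambda1_gt_ones; rewrite sE nE; lra.
- have s2 : (#|S| == 1%N) || (#|S| == 2%N) by lia.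
  exists 3%N, (62 / 10); split=> //; split; [lra | lra |].
  by apply: dist_lambda1_gt_ones; case/orP: s2 => /eqP ->; rewrite nE; lra.
have s3 : [|| #|S| == 1%N, #|S| == 2%N | #|S| == 3%N] by lia.
exists 4%N, (8773 / 1000); split=> //; split; [lra | lra |].
case/or3P: s3 => /eqP sE.
(* The all-ones quotient is [8.5], below [c]. The weights 17, 20, 29 approximate the Perron vector
   of [H_1] and give [30986 / 3530], about 8.778. *)
- apply: (dist_lambda1_gt (a := 17) (b := 20) (d := 29) n2 se sep dSI cI) => //.
  by rewrite sE nE; lra.
- by apply: dist_lambda1_gt_ones; rewrite sE nE; lra.
- by apply: dist_lambda1_gt_ones; rewrite sE nE; lra.
Qed.

End Separation.

(** * Exclusion of non-empty barriers *)

(** Treats both reference graphs at once: a barrier of size [s0] forces an isomorphism with the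
    reference graph, and any other size contradicts the assumed strict separation. *)
Lemma no_barrier_of_lambda1 (R : realType) n (e : rel 'I_n) (k s0 : nat) (S0 I0 : {set 'I_n}) :
  2 < n -> 2 <= k -> ~~ odd k -> simple_graph e -> 0 < s0 ->
  #|S0| = s0 -> #|I0| = s0 -> [disjoint S0 & I0] ->
  (lambda1 (dist_matrix R e) <= lambda1 (dist_matrix R (core_graph S0 I0)))%R ->
  ~ graph_iso e (core_graph S0 I0) ->
  (forall S I : {set 'I_n}, [disjoint S & I] -> #|I| = #|S| ->
     (forall u v, u \in I -> v \notin S -> ~~ e u v) -> 0 < #|S| -> #|S| != s0 ->
     (lambda1 (dist_matrix R (core_graph S0 I0)) < lambda1 (dist_matrix R e))%R) ->
  no_nonempty_barrier k e.
Proof.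
move=> n2 k2 ke [se ie] s0P cS0 cI0 d0 le niso lt S; rewrite -card_gt0 => Sn0 bS.
have [I [cI dSI sep]] := barrier_core (ltnW k2) ke bS.
have [sE|sN] := eqVneq #|S| s0.
  apply: niso; apply: (core_graph_extremal n2 se ie sep dSI d0 _ _ _ le).
  - by rewrite -card_gt0 cS0.
  - by rewrite sE.
  - by rewrite cI sE.
by have := lt S I dSI cI sep Sn0 sN; rewrite ltNge le.
Qed.

Theorem theorem5 (R : realType) (k n : nat) (e : rel 'I_n) :
  2 <= k -> ~~ odd k -> 3 <= n ->
  simple_graph e -> connected_graph e ->
  ((lambda1 (dist_matrix R e) <= lambda1 (dist_matrix R (join_K1_Kn2_K1 n)))%R ->
   ~ graph_iso e (join_K1_Kn2_K1 n) ->
   (odd n -> GFC k e) /\ (~~ odd n -> 10 <= n -> GBC k e)) /\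
  (~~ odd n -> 4 <= n <= 8 ->
   (lambda1 (dist_matrix R e) <= lambda1 (dist_matrix R (S_nk n n./2)))%R ->
   ~ graph_iso e (S_nk n n./2) -> GBC k e).
Proof.
move=> k2 ke n3 ge ce; have [se ie] := ge; have n1 := ltnW n3.
split=> [le niso | ne n48 le niso].
  suff nb : odd n || (9 < n) -> no_nonempty_barrier k e.
    by split=> [on|ne n10]; do 2!split=> //; apply: nb; rewrite ?on ?n10 ?orbT.
  have [cS cI] := card_join_core n1; have := disjoint_join_core n1.
  move: cS cI le niso; rewrite join_core_graph => cS cI le niso dj nP.
  apply: (no_barrier_of_lambda1 n3 k2 ke ge _ cS cI dj le niso) => // S I dSI cSI sep s0 s1.
  by rewrite -join_core_graph; apply: lambda1_join_lt dSI cSI sep nP _ => //; lia.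
split=> //; split=> //.
have mn : n./2 <= n by lia.
have cS := card_ord_lt mn.
have cI : #|~: [set x : 'I_n | (x : nat) < n./2]| = n./2.
  by rewrite cardsCs finset.setCK card_ord cS; lia.
move: le niso; rewrite S_nk_core_graph S_nk_coreC => le niso.
apply: (no_barrier_of_lambda1 n3 k2 ke ge _ cS cI (disjoint_setC _) le niso) => //; first by lia.
move=> S I dSI cSI sep s0 s1; rewrite -S_nk_coreC -S_nk_core_graph.
(* From [2 s <= n] and [s != n./2] follows [s < n./2], the range covered by the separation. *)
have := double_core_le dSI cSI => sn.
by apply: lambda1_S_nk_lt n3 se dSI cSI sep ne n48 _; lia.
Qed.
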